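(* For $T>0$, let $\sigma_1(T)=\sup_{f\in\mathcal{L}_2(T)}\int_0^T|f'(t)|\,dt$. For $0<T\le 2$, one has $\sigma_1(T)=2$.
   Context: For $T>0$, $\mathcal{L}_2(T)$ is the set of functions $f:[0,T]\to\mathbb{R}$ that are differentiable on $[0,T]$ (one-sided at the endpoints), with $f'$ absolutely continuous, such that $|f(t)|\le 1$ for all $t\in[0,T]$ and $|f''(t)|\le 1$ for almost every $t\in[0,T]$ (equivalently, $|f|\le1$ and $f'$ is $1$-Lipschitz). *)

(* Defs.v *)
From HB Require Import structures.
From mathcomp Require Import all_boot all_order all_algebra.
From mathcomp Require Import all_classical all_reals all_analysis.

Set Implicit Arguments.
Unset Strict Implicit.
Unset Printing Implicit Defensive.

Import Order.TTheory GRing.Theory Num.Theory.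
Import numFieldNormedType.Exports.

Local Open Scope classical_set_scope.
Local Open Scope ring_scope.

(* Derivative relative to a set A: the difference quotient is only taken at    *)
(* points s of A, so that for A = [0, T] this is the two-sided derivative at   *)
(* interior points and the one-sided derivative at 0 and at T. [derive_in] is  *)
(* meaningful only where [derivable_in] holds (lim is total).                  *)
Definition diff_quotient (R : realType) (f : R -> R) (t s : R) : R :=
  (f s - f t) / (s - t).

Definition derivable_in (R : realType) (A : set R) (f : R -> R) (t : R) : Prop :=
  cvg (diff_quotient f t s @[s --> within A t^']).

Definition derive_in (R : realType) (A : set R) (f : R -> R) (t : R) : R :=
  lim (diff_quotient f t s @[s --> within A t^']).

Definition absolutely_continuous_on (R : realType) (a b : R) (g : R -> R)
    : Prop :=
  forall e : R, 0 < e -> exists2 d : R, 0 < d &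
    forall (n : nat) (u v : 'I_n -> R),
      (forall i, [/\ a <= u i, u i < v i & v i <= b]) ->
      trivIset setT (fun i => `]u i, v i[%classic) ->
      \sum_(i < n) (v i - u i) < d ->
      \sum_(i < n) `|g (v i) - g (u i)| < e.

(* A function [0, T] -> R is represented by a function R -> R of which only    *)
(* the values on [0, T] matter: every clause below, and the integral in        *)
(* [sigma1], depends only on the restriction of f to [0, T].                   *)
Definition L2class (R : realType) (T : R) : set (R -> R) :=
  [set f | [/\ forall t : R, t \in `[0, T] -> derivable_in `[0, T]%classic f t,
               absolutely_continuous_on 0 T (derive_in `[0, T]%classic f),
               forall t : R, t \in `[0, T] -> `|f t| <= 1 &
               {ae lebesgue_measure, forall t : R, t \in `[0, T] ->
                  derivable_in `[0, T]%classic (derive_in `[0, T]%classic f) t /\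
                  `|derive_in `[0, T]%classic (derive_in `[0, T]%classic f) t| <= 1}]].

Definition sigma1 (R : realType) (T : R) : \bar R :=
  ereal_sup [set (\int[lebesgue_measure]_(t in `[0%R, T])
                    (`|derive_in `[0%R, T]%classic f t|%R)%:E)%E | f in L2class T].

(* Main.v *)
Require Import Defs.
From mathcomp Require Import all_boot all_order all_algebra.
From mathcomp Require Import all_classical all_reals all_analysis.
From mathcomp Require Import measurable_realfun ring lra.

Import Order.TTheory GRing.Theory Num.Theory.
Import numFieldNormedType.Exports.

Local Open Scope classical_set_scope.
Local Open Scope ring_scope.

(** The affine map from -1 to 1 has variation 2. Conversely, g = f' is
    1-Lipschitz. If g has no zero then it has constant sign and
    int |g| = |f T - f 0| <= 2; if g vanishes at c then |g t| <= |t - c|, whose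
    integral over [0, T] is at most T^2 / 2 <= 2.

    The Lipschitz bound from |g'| <= 1 almost everywhere: cover the exceptional
    null set by an open set U of small measure and go from x to y by small steps,
    each either inside U or around a point where g' exists. The steps of the
    first kind contribute little by absolute continuity. *)

(** * Derivatives relative to a set *)

(** Clearing the denominator admits [s = t]. This form serves the Lipschitz bound, the comparison
    with ordinary derivatives, and continuity. *)
Lemma derive_in_expansion (R : realType) (A : set R) (f : R -> R) (t e : R) :
  derivable_in A f t -> 0 < e ->
  exists2 d : R, 0 < d & forall s, A s -> `|s - t| < d ->
    `|f s - f t - derive_in A f t * (s - t)| <= e * `|s - t|.
Proof.
move=> df e0.
have /nbhs_ballP[d /= d0 fd] : nbhs t [set s | s != t -> A s ->
    `|derive_in A f t - diff_quotient f t s| <= e].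
  by have /cvgrPdist_le/(_ e e0) := df.
exists d => // s As std.
have [->|st] := eqVneq s t; first by rewrite !subrr mulr0 subr0 normr0 mulr0.
have st0 : s - t != 0 by rewrite subr_eq0.
have -> : f s - f t - derive_in A f t * (s - t) =
    - (derive_in A f t - diff_quotient f t s) * (s - t).
  by rewrite /diff_quotient; field.
rewrite normrM normrN ler_wpM2r// fd//.
by rewrite /ball/= distrC.
Qed.

Lemma derive_in_cst (R : realType) (a b k : R) (f : R -> R) (t : R) :
  a < b -> t \in `[a, b] ->
  (forall s, s \in `[a, b] -> f s - f t = k * (s - t)) ->
  derivable_in `[a, b] f t /\ derive_in `[a, b] f t = k.
Proof.
move=> ab tab fk.
(* Limits are unique only along a proper filter: [t] must be a limit point of [[a, b]], which rests
   on [a < b]. The witness lies to the right of [t] if [t < b], and to the left of [t = b]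
   otherwise. *)
have Fprop : ProperFilter (within `[a, b] t^').
  apply: Build_ProperFilter_ex => P.
  rewrite /dnbhs /within /= => /nbhs_ballP[d /= d0 dP].
  move: tab; rewrite in_itv/= => /andP[at_ tb].
  have [tb'|bt] := ltP t b.
    exists (Num.min b (t + d / 2)); apply: dP => /=.
    - by rewrite /ball/= ltr_norml; case: (leP b (t + d / 2)); lra.
    - by rewrite eq_sym lt_eqF// lt_min; lra.
    - by rewrite in_itv/= ge_min le_min lexx/=; lra.
  exists (Num.max a (t - d / 2)); apply: dP => /=.
  - by rewrite /ball/= ltr_norml; case: (leP a (t - d / 2)); lra.
  - by rewrite lt_eqF// gt_max; lra.
  - by rewrite in_itv/= ge_max le_max lexx/=; lra.
have dk : diff_quotient f t s @[s --> within `[a, b] t^'] --> k.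
  apply/cvgrPdist_le => e e0; rewrite /dnbhs !near_withinE.
  apply: nearW => s st sab.
  rewrite /diff_quotient fk// mulfK ?subr_eq0// subrr normr0; exact: ltW.
split; first by apply/cvg_ex; exists k.
by apply: cvg_lim dk.
Qed.

(** * Lipschitz bound from an almost everywhere derivative bound *)

(** Induction along an interval, by completeness: at [t], the supremum of the points reached, a step
    from a reached point just left of [t] would pass [t], unless it ends at [b]. *)
Lemma itv_step_ind (R : realType) (P : R -> Prop) (a b : R) :
  a <= b -> P a ->
  (forall t, a <= t <= b -> exists2 d, 0 < d & forall x y,
     a <= x <= t -> t <= y <= b -> t - d < x -> y < t + d -> P x -> P y) ->
  P b.
Proof.
move=> ab Pa step; pose S := [set x | a <= x <= b /\ P x].
have Sa : S a by rewrite /S/= lexx ab.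
have hS : has_sup S by split; [exists a|exists b => x [/andP[]]].
have aS : a <= sup S by apply: ub_le_sup => //; case: hS.
have Sb : sup S <= b by apply: ge_sup; [exists a|move=> x [/andP[]]].
have [|d d0 stepd] := step (sup S); first by rewrite aS.
have [c [/andP[ac cb] Pc] cS] := sup_adherent d0 hS.
have cS' : c <= sup S by apply: ub_le_sup => //; [case: hS|split => //; rewrite ac].
pose y := Num.min b (sup S + d / 2).
have Py : P y.
  apply: (stepd c) => //; rewrite ?ac// /y ?le_min ?ge_min ?gt_min ?lexx ?Sb//=; lra.
have yS : y <= sup S.
  apply: ub_le_sup; first by case: hS.
  by split => //; rewrite /y le_min ge_min lexx; lra.
move: yS Py; rewrite /y; case: (leP b) => // _; lra.
Qed.

Lemma sum_disjoint_itv_le (R : realType) (U : set R) n (u v : 'I_n -> R) :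
  measurable U -> (forall i, u i < v i) -> (forall i, `]u i, v i[ `<=` U) ->
  trivIset setT (fun i => `]u i, v i[%classic) ->
  ((\sum_(i < n) (v i - u i))%:E <= lebesgue_measure U)%E.
Proof.
move=> mU uv uvU tuv.
rewrite -sumEFin.
rewrite (eq_bigr (fun i => lebesgue_measure (`]u i, v i[%classic : set R))).
  rewrite -measure_bigsetU_ord//.
  apply: le_measure; rewrite ?inE//; first exact: bigsetU_measurable.
  by apply: (big_ind (fun A => A `<=` U)) => // A B AU BU x [/AU|/BU].
by move=> i _; rewrite lebesgue_measure_itv/= lte_fin uv EFinB.
Qed.

Lemma negligible_open_cover (R : realType) (N : set R) (e : R) : 0 < e ->
  (@lebesgue_measure R).-negligible N ->
  exists U : set R, [/\ open U, N `<=` U & (lebesgue_measure U < e%:E)%E].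
Proof.
move=> e0 N0.
have [N' [mN' N'0 NN']] : exists A : set R,
  [/\ measurable A, lebesgue_measure A = 0%E & N `<=` A] by exact: N0.
have [|U [oU N'U Ue]] := lebesgue_regularity_outer mN' _ e0.
  by suff : (lebesgue_measure N' < +oo)%E by []; rewrite N'0 ltry.
exists U; split => //; first exact: subset_trans N'U.
(* Outer regularity bounds only the excess of [U] over [N']; adding the null set [N'] back costs
   nothing. *)
rewrite (_ : U = (U `\` N') `|` N'); last by rewrite setUC setDUK.
apply: le_lt_trans Ue.
have mU : measurable U by exact: open_measurable.
rewrite -[leRHS]adde0 -[in leRHS]N'0; apply: measureU2 => //.
exact: measurableD.
Qed.

(** Absolute continuity for steps recorded one at a time. The list runs from right to left, and this
    order yields the disjointness that the indexed form asks for. *)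
Lemma ac_sum_lt (R : realType) (a b e d : R) (g : R -> R) (U : set R)
    (s : seq (R * R)) :
  (forall (n : nat) (u v : 'I_n -> R),
      (forall i, [/\ a <= u i, u i < v i & v i <= b]) ->
      trivIset setT (fun i => `]u i, v i[%classic) ->
      \sum_(i < n) (v i - u i) < d ->
      \sum_(i < n) `|g (v i) - g (u i)| < e) ->
  measurable U -> (lebesgue_measure U < d%:E)%E ->
  (forall p, p \in s -> [/\ a <= p.1, p.1 < p.2, p.2 <= b & `]p.1, p.2[ `<=` U]) ->
  pairwise (fun p q : R * R => q.2 <= p.1) s ->
  \sum_(p <- s) `|g p.2 - g p.1| < e.
Proof.
move=> ac mU Ud sP ps.
pose p i := nth (0, 0) s i.
have pP i : (i < size s)%N ->
    [/\ a <= (p i).1, (p i).1 < (p i).2, (p i).2 <= b & `](p i).1, (p i).2[ `<=` U].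
  by move=> si; apply: sP; exact: mem_nth.
have tp : trivIset setT (fun i : 'I_(size s) => `](p i).1, (p i).2[%classic).
  have ltp (i j : 'I_(size s)) : (i < j)%N -> (p j).2 <= (p i).1.
    by move=> ij; have /(pairwiseP (0, 0)) := ps; apply; rewrite ?inE.
  move=> i j _ _ [x /= []]; rewrite !in_itv/= => /andP[xi ix] /andP[xj jx].
  have [/ltp ji|/ltp ij|/val_inj//] := ssrnat.ltngtP i j.
    by have := lt_trans (lt_le_trans jx ji) xi; rewrite ltxx.
  by have := lt_trans (lt_le_trans ix ij) xj; rewrite ltxx.
rewrite (big_nth (0, 0)) big_mkord.
apply: (ac _ (fun i => (p i).1) (fun i => (p i).2)) => //.
  by move=> i; have [] := pP _ (ltn_ord i).
rewrite -lte_fin; apply: le_lt_trans Ud.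
by apply: sum_disjoint_itv_le => // i; have [] := pP _ (ltn_ord i).
Qed.

Lemma ac_ae_derive_le_lipschitz (R : realType) (a b M : R) (g : R -> R) :
  0 <= M -> absolutely_continuous_on a b g ->
  {ae lebesgue_measure, forall t : R, t \in `[a, b] ->
    derivable_in `[a, b] g t /\ `|derive_in `[a, b] g t| <= M} ->
  forall x y, a <= x -> x <= y -> y <= b -> `|g y - g x| <= M * (y - x).
Proof.
move=> M0 ac aeM x y ax xy yb.
suff key e : 0 < e -> `|g y - g x| <= (M + e) * (y - x) + e.
  apply/ler_addgt0Pr => e e0.
  (* With slack [e / (y - x + 1)] the total error, slack times [y - x] plus slack, is exactly [e];
     the [+ 1] covers [x = y]. *)
  have c0 : 0 < y - x + 1 by lra.
  have := key (e / (y - x + 1)) (divr_gt0 e0 c0).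
  rewrite mulrDl -addrA -[X in _ + (_ + X)]mulr1 -mulrDr divfK//.
  by rewrite gt_eqF.
move=> e0.
have [d d0 {}ac] := ac e e0.
have [U [oU NU Ud]] := negligible_open_cover _ _ _ d0 aeM.
have mU : measurable U by exact: open_measurable.
(* P z: from x one can reach z, s listing the steps taken inside U, last first. *)
pose P z := exists s : seq (R * R), [/\
   forall p, p \in s -> [/\ a <= p.1, p.1 < p.2, p.2 <= z & `]p.1, p.2[ `<=` U],
   pairwise (fun p q : R * R => q.2 <= p.1) s &
   `|g z - g x| <= (M + e) * (z - x) + \sum_(p <- s) `|g p.2 - g p.1| ].
(* The recorded steps are disjoint intervals inside [U], whose measure is below [d], so their
   increments sum to less than [e]. *)
suff [s [sP ps gs]] : P y.
  apply: le_trans gs _; rewrite lerD2l; apply/ltW.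
  apply: ac_sum_lt ac mU Ud _ ps => p /sP[? ? py ?]; split => //.
  exact: le_trans yb.
have stepL z w : x <= z -> z <= w -> `|g w - g z| <= (M + e) * (w - z) -> P z -> P w.
  move=> xz zw gzw [s [sP ps gs]]; exists s; split => //.
    by move=> p /sP[? ? pz ?]; split => //; exact: le_trans zw.
  have := ler_distD (g z) (g w) (g x); lra.
(* The increment over a step inside [U] is paid for by the new list entry; the linear term can only
   grow. *)
have stepU z w : x <= z -> z < w -> `]z, w[ `<=` U -> P z -> P w.
  move=> xz zw zwU [s [sP ps gs]]; exists ((z, w) :: s); split => //.
  - move=> p; rewrite inE => /predU1P[->/=|/sP[? ? pz ?]]; split => //.
      exact: le_trans xz.
    exact: le_trans (ltW zw).
  - by rewrite pairwise_cons ps andbT; apply/allP => p /sP[].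
  rewrite big_cons/=.
  have := ler_distD (g z) (g w) (g x).
  have : (M + e) * (z - x) <= (M + e) * (w - x) by rewrite ler_wpM2l; lra.
  lra.
apply: itv_step_ind xy _ _.
  by exists [::]; split => //; rewrite big_nil !subrr normr0 mulr0 addr0.
move=> t /andP[xt ty].
have [tU|tNU] := pselect (U t).
  have [r /= r0 rU] : nbhs_ball t U by apply/nbhs_ballP; exact: open_nbhs_nbhs.
  exists r => // z w /andP[xz zt] /andP[tw wy] tz wt.
  (* Listed intervals must be nondegenerate, so [z = w] is set apart. *)
  have [zw|wz] := ltP z w; last by have -> : z = w by lra.
  apply: stepU => // s; rewrite /= in_itv/= => /andP[zs sw].
  by apply: rU; rewrite /ball/= ltr_norml; lra.
have [dt gt] : derivable_in `[a, b] g t /\ `|derive_in `[a, b] g t| <= M.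
  have : ~ ~ (t \in `[a, b] ->
    derivable_in `[a, b] g t /\ `|derive_in `[a, b] g t| <= M) by move=> /NU.
  by move=> /contrapT; apply; rewrite in_itv/=; lra.
have [r r0 tr] := derive_in_expansion _ _ _ _ _ dt e0.
have gtr s : a <= s <= b -> `|s - t| < r -> `|g s - g t| <= (M + e) * `|s - t|.
  move=> sab /tr -/(_ sab) H.
  have := ler_normD (g s - g t - derive_in `[a, b] g t * (s - t))
                    (derive_in `[a, b] g t * (s - t)).
  rewrite subrK normrM.
  have : `|derive_in `[a, b] g t| * `|s - t| <= M * `|s - t| by rewrite ler_wpM2r.
  lra.
(* The step straddles [t], so the distances from [t] to [z] and [w] add up to [w - z], and the two
   expansions at [t] combine without loss. *)
exists r => // z w /andP[xz zt] /andP[tw wy] tz wt.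
apply: stepL => //; first lra.
have := gtr z; rewrite ltr_norml (ler0_norm (x := z - t)) ?subr_le0//.
have := gtr w; rewrite ltr_norml (ger0_norm (x := w - t)) ?subr_ge0//.
move=> gw gz.
have {}gw := gw ltac:(lra) ltac:(lra).
have {}gz := gz ltac:(lra) ltac:(lra).
have := ler_distD (g t) (g w) (g z).
rewrite (distrC (g t)); lra.
Qed.

(** * Fundamental theorem of calculus for relative derivatives *)

Lemma derive_in_is_derive (R : realType) (a b : R) (f : R -> R) (t : R) :
  t \in `]a, b[ -> derivable_in `[a, b] f t ->
  is_derive t 1 f (derive_in `[a, b] f t).
Proof.
rewrite in_itv/= => /andP[at_ tb] df.
set k := derive_in _ f t.
have fk : h^-1 *: ((f \o shift t) (h *: 1) - f t) @[h --> 0^'] --> k.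
  apply/cvgrPdist_le => e e0.
  have [d d0 fd] := derive_in_expansion _ _ _ _ _ df e0.
  have m0 : 0 < Num.min d (Num.min (t - a) (b - t)).
    by rewrite !lt_min d0 !subr_gt0 at_.
  (* The bounds [t - a] and [b - t] keep [h + t] inside [[a, b]]. *)
  apply/nbhs_ballP; exists (Num.min d (Num.min (t - a) (b - t))) => //= h; rewrite /ball/= sub0r normrN.
  rewrite !lt_min => /and3P[hd ha hb] h0.
  have abh : `[a, b]%classic (h + t).
    by move: ha hb; rewrite /= in_itv/= !ltr_norml; lra.
  have := fd _ abh; rewrite addrK => /(_ hd).
  rewrite -/k [h *: 1]mulr1 /GRing.scale/= => H.
  rewrite -(ler_pM2r (x := `|h|)) ?normr_gt0// -normrM.
  rewrite (_ : (k - _) * h = - (f (h + t) - f t - k * h)); last by field.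
  by rewrite normrN.
have dft : derivable f t 1 by apply/cvg_ex; exists k.
by apply: (DeriveDef dft); exact: cvg_lim fk.
Qed.

Lemma derivable_in_continuous (R : realType) (A : set R) (f : R -> R) :
  (forall t, A t -> derivable_in A f t) -> {within A, continuous f}.
Proof.
move=> df; apply/subspace_continuousP => t At.
have [d d0 fd] := derive_in_expansion _ _ _ _ _ (df _ At) ltr01.
set k := derive_in A f t in fd *.
apply/cvgrPdist_le => e e0; rewrite near_withinE.
(* The expansion with error 1 makes [f] vary near [t] by at most [|k| + 1] times the distance to
   [t]. *)
have K0 : 0 < `|k| + 1 by rewrite ltr_wpDl.
apply/nbhs_ballP; exists (Num.min d (e / (`|k| + 1))) => /=.
  by rewrite lt_min d0 divr_gt0.
move=> s; rewrite /ball/= lt_min => /andP[]; rewrite distrC => sd se As.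
have := fd _ As sd.
rewrite ltr_pdivlMr// in se.
have := ler_normD (f s - f t - k * (s - t)) (k * (s - t)).
rewrite subrK normrM (distrC (f t)) => H1 H2.
rewrite distrC in sd; nra.
Qed.

Lemma integral_derive_in (R : realType) (a b : R) (f : R -> R) : a < b ->
  (forall t, t \in `[a, b] -> derivable_in `[a, b] f t) ->
  {within `[a, b], continuous (derive_in `[a, b] f)} ->
  (\int[lebesgue_measure]_(t in `[a, b]) (derive_in `[a, b] f t)%:E
    = (f b - f a)%:E)%E.
Proof.
move=> ab df cf'.
have cf := derivable_in_continuous _ `[a, b]%classic f df.
have f' t : t \in `]a, b[ -> is_derive t 1 f (derive_in `[a, b] f t).
  by move=> tab; apply: derive_in_is_derive => //; apply: df; apply: subset_itv_oo_cc.
rewrite (@continuous_FTC2 _ _ f _ _ ab cf') ?EFinB//.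
  have /(continuous_within_itvP _ ab)[_ fa fb] := cf.
  by split => // t /f'[].
by move=> t /f' ft; rewrite derive1E; exact: (@derive_val _ _ _ _ _ _ _ ft).
Qed.

(** * Continuity, sign and an explicit integral *)

Lemma lipschitz_within_continuous (R : realType) (a b : R) (g : R -> R) :
  (forall x y, a <= x -> x <= y -> y <= b -> `|g y - g x| <= y - x) ->
  {within `[a, b], continuous g}.
Proof.
move=> lg; apply/subspace_continuousP => t /=; rewrite in_itv/= => /andP[at_ tb].
apply/cvgrPdist_le => e e0; rewrite near_withinE.
apply/nbhs_ballP; exists e => //= s; rewrite /ball/= => ts.
rewrite in_itv/= => /andP[as_ sb].
have [st|ts'] := leP s t.
  by apply: le_trans (lg _ _ as_ st tb) _; move: ts; rewrite ltr_norml; lra.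
rewrite distrC; apply: le_trans (lg _ _ at_ (ltW ts') sb) _.
by move: ts; rewrite ltr_norml; lra.
Qed.

(** The sign is a constant factor [k] so that it can be pulled out of the integral of [|g|]. *)
Lemma constant_sign (R : realType) (a b : R) (g : R -> R) : a <= b ->
  {within `[a, b], continuous g} ->
  (exists2 c, c \in `[a, b] & g c = 0) \/
  exists2 k : R, `|k| = 1 & forall t, t \in `[a, b] -> `|g t| = k * g t.
Proof.
move=> ab cg.
have [|n0] := pselect (exists2 c, c \in `[a, b] & g c = 0); first by left.
right; have same t : t \in `[a, b] -> 0 < g a * g t.
  (* If [g a * g t <= 0], then 0 lies between [g a] and [g t], and the intermediate value theorem
     gives a zero in [[a, t]]. *)
  rewrite in_itv/= => /andP[at_ tb]; rewrite ltNge; apply/negP => g0.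
  apply: n0.
  have cgt : {within `[a, t], continuous g}.
    by apply: continuous_subspaceW cg; apply: subset_itvl; rewrite bnd_simp.
  have [|c ct gc] := IVT at_ cgt (v := 0); last first.
    by exists c => //; move: ct; rewrite !in_itv/=; lra.
  by case: (leP (g a) (g t)) => ?; nra.
have ga : g a != 0.
  by apply/eqP => ga; apply: n0; exists a => //; rewrite in_itv/= lexx ab.
exists (Num.sg (g a)); first by rewrite normr_sg ga.
move=> t /same; rewrite -sgr_gt0 sgrM => st.
rewrite normrEsg; congr (_ * _).
by move: st; case: sgrP => //; case: sgrP => //; lra.
Qed.

Lemma integral_linear (R : realType) (T p q : R) : 0 < T ->
  (\int[lebesgue_measure]_(t in `[0%R, T]) (p + q * t)%:E
    = (p * T + q * T ^+ 2 / 2)%:E)%E.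
Proof.
move=> T0; pose F := (fun t : R => p * t + q * t ^+ 2 / 2) : R -> R.
have dF (x : R) : is_derive x 1 F (p + q * x).
  by apply: is_derive_eq; rewrite /GRing.scale/=; field.
have cF : continuous F.
  by move=> x; apply: differentiable_continuous; apply/derivable1_diffP; case: (dF x).
rewrite (@continuous_FTC2 _ _ F _ _ T0).
- by rewrite -EFinB /F; congr EFin; ring.
- by apply: continuous_subspaceT => x; apply: cvgD; [exact: cvg_cst|exact: cvgMr].
- split; first by move=> x _; case: (dF x).
    by apply: cvg_at_right_filter; exact: cF.
  by apply: cvg_at_left_filter; exact: cF.
- by move=> x _; rewrite derive1E; apply: derive_val.
Qed.

(** * The upper bound *)

Lemma L2class_derive_lipschitz (R : realType) (T : R) (f : R -> R) :
  L2class T f -> forall x y, 0 <= x -> x <= y -> y <= T ->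
  `|derive_in `[0, T] f y - derive_in `[0, T] f x| <= y - x.
Proof.
move=> [_ ac _ ae1] x y x0 xy yT; rewrite -[leRHS]mul1r.
exact: ac_ae_derive_le_lipschitz ac ae1 _ _ x0 xy yT.
Qed.

Lemma L2class_variation_le (R : realType) (T : R) (f : R -> R) :
  0 < T -> T <= 2 -> L2class T f ->
  (\int[lebesgue_measure]_(t in `[0%R, T])
      (`|derive_in `[0%R, T]%classic f t|%R)%:E <= 2%:E)%E.
Proof.
move=> T0 T2 Lf.
have lip := L2class_derive_lipschitz _ _ _ Lf.
case: Lf => df _ f1 _.
set g := derive_in _ f in lip *.
have cg : {within `[0, T], continuous g} by exact: lipschitz_within_continuous.
have mg : measurable_fun `[0, T] g.
  by apply: subspace_continuous_measurable_fun.
have [[c c0T gc]|[k k1 gk]] := constant_sign _ _ _ _ (ltW T0) cg.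
  move: c0T; rewrite in_itv/= => /andP[c0 cT].
  (* t |-> |t - c| is convex, hence below its chord c + q * t on [0, T]. *)
  pose p := c; pose q := 1 - c / T * 2.
  have qT : q * T = T - 2 * c by rewrite /q; field; rewrite gt_eqF.
  apply: (@le_trans _ _ (\int[lebesgue_measure]_(t in `[0%R, T]) (p + q * t)%:E)%E).
    have chord t : 0 <= t <= T -> `|g t| <= p + q * t.
      move=> /andP[t0 tT].
      (* After multiplication by [T], the chord exceeds [|t - c|] by [2 * t * (T - c)] left of [c]
         and by [2 * c * (T - t)] right of it. *)
      rewrite -(ler_pM2r T0) mulrDl mulrAC qT /p.
      have [tc|ct] := leP t c.
        have : 0 <= t * (T - c) by rewrite mulr_ge0 ?subr_ge0.
        have := ler_wpM2r (ltW T0) (lip _ _ t0 tc cT); rewrite gc sub0r normrN; lra.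
      have : 0 <= c * (T - t) by rewrite mulr_ge0 ?subr_ge0.
      have := ler_wpM2r (ltW T0) (lip _ _ c0 (ltW ct) tT); rewrite gc subr0; lra.
    apply: ge0_le_integral => //.
    - by apply/measurable_EFinP; apply: measurableT_comp.
    - apply/measurable_EFinP; apply: measurable_funD => //; exact: measurable_funM.
  (* Since [q * T = T - 2 * c], the terms in [c] cancel and the integral is [T ^+ 2 / 2], wherever
     the zero lies. *)
  rewrite integral_linear// lee_fin /p expr2 mulrA qT; nra.
have ig : lebesgue_measure.-integrable `[0, T] (EFin \o g).
  by apply: continuous_compact_integrable => //; exact: segment_compact.
have -> : (\int[lebesgue_measure]_(t in `[0%R, T]) (`|g t|)%:E =
           \int[lebesgue_measure]_(t in `[0%R, T]) (k%:E * (g t)%:E))%E.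
  by apply: eq_integral => t /[!inE] /gk ->; rewrite EFinM.
rewrite integralZl// integral_derive_in// -EFinM lee_fin.
apply: le_trans (ler_norm _) _; rewrite normrM k1 mul1r.
apply: le_trans (ler_normB _ _) _.
rewrite -[leRHS]/(1 + 1) lerD// f1// in_itv/= lexx ltW//.
Qed.

(** * The extremal affine map and the conclusion *)

Lemma affine_in_L2class (R : realType) (T : R) : 0 < T ->
  L2class T (fun t => -1 + 2 / T * t) /\
  forall t, t \in `[0, T] -> derive_in `[0, T] (fun t => -1 + 2 / T * t) t = 2 / T.
Proof.
move=> T0; set f := fun t => _.
have f' t : t \in `[0, T] ->
    derivable_in `[0, T] f t /\ derive_in `[0, T] f t = 2 / T.
  by move=> t0T; apply: derive_in_cst => // s _; rewrite /f; ring.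
(* The first derivative is known to be constant only on [[0, T]], which suffices because difference
   quotients are restricted to that set. *)
have f'' t : t \in `[0, T] -> derivable_in `[0, T] (derive_in `[0, T] f) t /\
    derive_in `[0, T] (derive_in `[0, T] f) t = 0.
  move=> t0T; apply: derive_in_cst => // s s0T.
  by rewrite (f' _ t0T).2 (f' _ s0T).2 subrr mul0r.
split; last by move=> t /f'[].
split.
- by move=> t /f'[].
- move=> e e0; exists 1 => // n u v uv _ _; rewrite big1// => i _.
  have [ui uvi vi] := uv i.
  by rewrite !(f' _ _).2 ?subrr ?normr0// in_itv/=; lra.
- move=> t; rewrite in_itv/= /f => /andP[t0 tT].
  have : 0 <= 2 / T * t <= 2 by rewrite mulrAC ler_pdivrMr// divr_ge0//=; lra.
  by rewrite ler_norml; lra.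
- by apply: aeW => t /f''[dt ->]; rewrite normr0.
Qed.

Theorem proposition24 (R : realType) (T : R) (T0 : 0 < T) (T2 : T <= 2) :
  sigma1 T = 2%:E.
Proof.
apply/eqP; rewrite eq_le; apply/andP; split.
  by apply: ge_ereal_sup => _ [f Lf <-]; exact: L2class_variation_le.
have [Lf f'] := affine_in_L2class _ _ T0.
(* The supremum is attained: constant slope [2 / T] over length [T] integrates to 2. *)
apply: ereal_sup_ubound; exists (fun t => -1 + 2 / T * t) => //.
have -> : (\int[lebesgue_measure]_(t in `[0%R, T])
    (`|derive_in `[0, T] (fun t => -1 + 2 / T * t)%R t|)%:E =
    \int[lebesgue_measure]_(t in `[0%R, T]) (2 / T)%:E)%E.
  by apply: eq_integral => t /[!inE] /f' ->; rewrite ger0_norm// divr_ge0// ltW.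
rewrite integral_cst//= lebesgue_measure_itv/= lte_fin T0 -EFinB -EFinM.
by rewrite subr0 divfK// gt_eqF.
Qed.
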